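(* Let $(A,\cdot)$ be a finite group, let $\mathcal S^0_A$ be the set of all regular subsets $S\subset\operatorname{Hol}(A)$ with $(1_A,\operatorname{id}_A)\in S$, and regard $\mathcal S^0_A$ as the vertex set of the quiver that has, for every $S\in\mathcal S^0_A$ and every $(a,f)\in S$, exactly one arrow (labelled $a$) from $S$ to $(a,f)^{-1}S$. Let $N^A_s$ be the number of connected components of this quiver having exactly $s$ vertices. Then the shape of the quiver (its isomorphism class as an unlabelled directed multigraph) is determined by the string of integers $\{N^A_s\}_s$; moreover $N^A_s=0$ if $s\nmid|A|$, and $$\sum_s s\,N^A_s=|\mathcal S^0_A|=|\operatorname{Aut}(A)|^{|A|-1}.$$
   Context: $\operatorname{Hol}(A)=A\rtimes\operatorname{Aut}(A)$, with product $(a,f)(b,g)=(a\cdot f(b),fg)$. For $\alpha\in\operatorname{Hol}(A)$ and $S\subseteq\operatorname{Hol}(A)$, $\alpha S=\{\alpha\beta:\beta\in S\}$. A subset $S\subseteq\operatorname{Hol}(A)$ is regular if the projection $\operatorname{Hol}(A)\to A$, $(a,f)\mapsto a$, restricts to a bijection $S\to A$. Connected components of a quiver are taken in the undirected sense (two vertices are in the same component if they are joined by a path in which arrows may be traversed in either direction), and contain all arrows between their vertices.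
   Formalization: The string determines the shape only among groups that are both trivial or both nontrivial: groups of order 1 and 2 both have N_1 = 1 and no other components, but their quivers have one vertex with one loop and with two loops respectively, so this pair is excluded. *)

(* Defs.v *)
From HB Require Import structures.
From mathcomp Require Import all_boot all_fingroup.

Set Implicit Arguments.
Unset Strict Implicit.
Unset Printing Implicit Defensive.

Import GroupScope.

Record lquiver (L : Type) := LQuiver {
  vertex : finType;
  arrow : finType;
  source : arrow -> vertex;
  target : arrow -> vertex;
  label : arrow -> L
}.

(* Isomorphism of the underlying directed multigraphs: labels are ignored, so *)
(* the two label types need not be related.                                   *)
Definition same_shape (L M : Type) (Q : lquiver L) (R : lquiver M) : Prop :=
  exists (v : vertex Q -> vertex R) (e : arrow Q -> arrow R),
    [/\ bijective v, bijective e,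
        forall x, source (e x) = v (source x)
      & forall x, target (e x) = v (target x)].

Section Components.

Variables (L : Type) (Q : lquiver L).

Definition adjacent : rel (vertex Q) := [rel x y |
  [exists e : arrow Q, ((source e == x) && (target e == y))
                    || ((source e == y) && (target e == x))]].

Definition components : {set {set vertex Q}} :=
  equivalence_partition (connect adjacent) [set: vertex Q].

Definition num_components (s : nat) : nat :=
  #|[set C in components | #|C| == s]|.

End Components.

Section Holomorph.

Variable A : finGroupType.

(* A record rather than a pair, since A * [subg Aut [set: A]] already carries *)
(* the direct product group structure.                                        *)
Record hol := Hol { hol_elt : A; hol_aut : [subg Aut [set: A]] }.

Definition pair_of_hol (x : hol) := (hol_elt x, hol_aut x).
Definition hol_of_pair p := Hol p.1 p.2.
Lemma pair_of_holK : cancel pair_of_hol hol_of_pair.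
Proof. by case. Qed.

HB.instance Definition _ := Finite.copy hol (can_type pair_of_holK).

Definition hol_app (x : hol) (b : A) : A := sgval (hol_aut x) b.

(* Permutations compose left to right: (g * f) c = f (g c), so g * f below is *)
(* the automorphism written fg when maps compose right to left.               *)
Definition hol_mul (x y : hol) : hol :=
  Hol (hol_elt x * hol_app x (hol_elt y)) (hol_aut y * hol_aut x).
Definition hol_one : hol := Hol 1 1.
Definition hol_inv (x : hol) : hol :=
  Hol (sgval (hol_aut x)^-1 (hol_elt x)^-1) (hol_aut x)^-1.

Lemma hol_appM x : {morph hol_app x : a b / a * b}.
Proof.
have /setIdP[_ /morphicP fM] := subgP (hol_aut x).
by move=> a b; apply: fM; rewrite inE.
Qed.

Lemma hol_app1 x : hol_app x 1 = 1.
Proof. by apply: (mulgI (hol_app x 1)); rewrite -hol_appM !mulg1. Qed.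

Lemma hol_app_inj x : injective (hol_app x).
Proof. exact: perm_inj. Qed.

Lemma hol_mulA : associative hol_mul.
Proof.
move=> x y z; rewrite /hol_mul /=; congr Hol; last by rewrite mulgA.
by rewrite hol_appM -mulgA /hol_app /= permM.
Qed.

Lemma hol_mul1 : left_id hol_one hol_mul.
Proof.
by case=> a f; rewrite /hol_mul /hol_app /= perm1 mul1g mulg1.
Qed.

Lemma hol_mulV : left_inverse hol_one hol_inv hol_mul.
Proof.
move=> x; rewrite /hol_mul /=; congr Hol; last by rewrite mulgV.
by rewrite -[LHS](hol_appM (hol_inv x)) mulVg hol_app1.
Qed.

HB.instance Definition _ :=
  Finite_isGroup.Build hol hol_mulA hol_mul1 hol_mulV.

Definition regular (S : {set hol}) : bool :=
  dinjectiveb hol_elt S && (hol_elt @: S == [set: A]).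

Definition regular0 : {pred {set hol}} :=
  [pred S : {set hol} | regular S & 1 \in S].

Lemma regular0_lcoset (S : {set hol}) (x : hol) :
  S \in regular0 -> x \in S -> x^-1 *: S \in regular0.
Proof.
case/andP=> /andP[/dinjectiveP injS /eqP imS] _ xS.
have injy y : {in y *: S &, injective hol_elt}.
  move=> _ _ /lcosetP[u uS ->] /lcosetP[v vS ->] /= /mulgI /hol_app_inj.
  by move/(injS _ _ uS vS)->.
apply/andP; split; last by rewrite mem_lcoset invgK mulg1.
apply/andP; split; first by apply/dinjectiveP; apply: injy.
rewrite eqEcard subsetT (card_in_imset (injy x^-1)) card_lcoset -imS.
exact: leq_imset_card.
Qed.

Definition hol_vertex := {S : {set hol} | S \in regular0}.
Definition hol_arrow :=
  {p : hol_vertex * hol | p.2 \in val p.1}.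
HB.instance Definition _ := Finite.on hol_vertex.
HB.instance Definition _ := Finite.on hol_arrow.

Definition hol_source (e : hol_arrow) : hol_vertex := (val e).1.
Definition hol_target (e : hol_arrow) : hol_vertex :=
  Sub ((val e).2^-1 *: val (hol_source e))
      (regular0_lcoset (valP (hol_source e)) (valP e)).
Definition hol_label (e : hol_arrow) : A := hol_elt (val e).2.

Definition hol_quiver : lquiver A := LQuiver hol_source hol_target hol_label.

End Holomorph.

Arguments regular0 : clear implicits.

(* Main.v *)
Require Import Defs.
From mathcomp Require Import all_boot all_fingroup all_solvable.

(** Since 1 lies in every vertex, the component of S consists of the translates
    x^-1 S for x in S.  The elements of S sending S to a given translate form a
    coset of T = {x in S | x^-1 S = S}, so the component is a complete digraph
    on |A| / |T| vertices in which every arrow is repeated |T| times.  Hence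
    the shape depends only on |A| and the numbers N_s.
    For |A| >= 3 the integer |A| is the largest s with N_s <> 0: Aut A contains
    some f <> 1, and T is trivial for S = {1} + {(a, f) | a <> 1}.  When
    |A| <= 2 there is a single vertex, whence the hypothesis relating |A| = 1
    to |B| = 1. *)

Set Implicit Arguments.
Unset Strict Implicit.
Unset Printing Implicit Defensive.

(** * Bijections between finite types over a common base *)

Section FibreBijection.

Variable T : eqType.

(** Equinumerous fibres can be matched by rank: [x] goes to the element of the fibre of [g] over
    [f x] whose position in the enumeration is that of [x] in its own fibre. *)
Lemma fibre_injection (X Y : finType) (f : X -> T) (g : Y -> T) :
    (forall t, #|[pred x | f x == t]| = #|[pred y | g y == t]|) ->
  exists2 h : X -> Y, injective h & forall x, g (h x) = f x.
Proof.
move=> fg.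
have gP x : exists y, g y == f x.
  suff /card_gt0P[y gy] : 0 < #|[pred y | g y == f x]| by exists y.
  by rewrite -fg; apply/card_gt0P; exists x; rewrite inE.
pose F t := enum [pred x | f x == t]; pose G t := enum [pred y | g y == t].
have ltG x : index x (F (f x)) < size (G (f x)).
  by rewrite -cardE -fg cardE index_mem mem_enum inE.
(* The default of [nth] varies with [x] but is never returned, by [ltG]; this allows exchanging
   defaults when proving injectivity. *)
pose h x := nth (xchoose (gP x)) (G (f x)) (index x (F (f x))).
have hP x : g (h x) = f x.
  by have := mem_nth (xchoose (gP x)) (ltG x); rewrite mem_enum inE => /eqP.
exists h => // x1 x2 h12.
have f12 : f x1 = f x2 by rewrite -!hP h12.
move: h12; rewrite /h (set_nth_default (xchoose (gP x2))) //.
have := ltG x1; rewrite f12 => lt1 /eqP; rewrite nth_uniq ?enum_uniq // => /eqP.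
by apply: (index_inj x1); rewrite mem_enum inE ?f12.
Qed.

Lemma fibre_bijection (X Y : finType) (f : X -> T) (g : Y -> T) :
    (forall t, #|[pred x | f x == t]| = #|[pred y | g y == t]|) ->
  exists2 h : X -> Y, bijective h & forall x, g (h x) = f x.
Proof.
move=> fg; have [h inj_h hP] := fibre_injection fg.
have [k inj_k _] := fibre_injection (fun t => esym (fg t)).
by exists h; first exact/(inj_card_bij inj_h)/(leq_card k).
Qed.

End FibreBijection.

(** * Components of a quiver and uniform arrow multiplicities *)

Section Quivers.

Variables (L : Type) (Q : lquiver L).

Lemma connect_adjacentC : connect_sym (@adjacent L Q).
Proof.
apply: sym_connect_sym => x y.
by apply: eq_existsb => e; rewrite orbC.
Qed.

Lemma connect_adjacent_equiv :
  {in [set: vertex Q] & &, equivalence_rel (connect (@adjacent L Q))}.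
Proof.
move=> x y z _ _ _; split=> [|xy]; first exact: connect0.
exact: (same_connect connect_adjacentC).
Qed.

Definition component (x : vertex Q) := pblock (components Q) x.

Lemma components_partition : partition (components Q) [set: vertex Q].
Proof. exact/equivalence_partitionP/connect_adjacent_equiv. Qed.

Lemma mem_component x y : (y \in component x) = connect (@adjacent L Q) x y.
Proof.
by rewrite (pblock_equivalence_partition connect_adjacent_equiv) ?inE.
Qed.

Lemma component_in x : component x \in components Q.
Proof. by rewrite pblock_mem // (cover_partition components_partition) inE. Qed.

Lemma componentE (C : {set vertex Q}) x :
  C \in components Q -> (component x == C) = (x \in C).
Proof.
have /and3P[_ tI _] := components_partition => CQ.
apply/eqP/idP => [<-|]; first by rewrite mem_component.
exact: def_pblock.
Qed.

Lemma component_eq x y :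
  (component x == component y) = connect (@adjacent L Q) x y.
Proof.
by rewrite componentE ?component_in // mem_component connect_adjacentC.
Qed.

Definition class_of x : {C | C \in components Q} :=
  Sub (component x) (component_in x).

Lemma card_class_of C : #|[pred x | class_of x == C]| = #|val C|.
Proof.
by apply: eq_card => x; rewrite !inE -val_eqE /= componentE ?(valP C).
Qed.

Lemma sum_num_components :
  \sum_(0 <= s < #|vertex Q|.+1) s * num_components Q s = #|vertex Q|.
Proof.
rewrite -[RHS]cardsT (card_partition components_partition) big_mkord.
(* Sizes are read as ordinals to get a finite index type; [inord] is faithful here because no
   component exceeds the vertex set. *)
pose card_ord (C : {set vertex Q}) : 'I_#|vertex Q|.+1 := inord #|C|.
rewrite (partition_big card_ord xpredT) //=.
apply: eq_bigr => s _; rewrite mulnC -sum_nat_const.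
apply: eq_big => [C|C]; rewrite inE; last by case/andP=> _ /eqP.
by rewrite -val_eqE /= inordK // ltnS max_card.
Qed.

Definition num_arrows (x y : vertex Q) :=
  #|[pred e : arrow Q | (source e == x) && (target e == y)]|.

(* The factor #|component x| stands on the left to avoid a rounded division. *)
Definition uniform_arrows n := forall x y : vertex Q,
  num_arrows x y * #|component x|
    = if connect (@adjacent L Q) x y then n else 0.

Lemma component_gt0 x : 0 < #|component x|.
Proof. by apply/card_gt0P; exists x; rewrite mem_component. Qed.

(** Uniformity at a pair [x], [x] writes [n] as the number of loops at [x] times the size of its
    component. *)
Lemma num_components_ndvd n s :
  uniform_arrows n -> ~~ (s %| n) -> num_components Q s = 0.
Proof.
move=> Qn; apply: contraNeq; rewrite -lt0n => /card_gt0P[C].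
rewrite inE => /andP[CQ /eqP <-].
have [C0|[x xC]] := set_0Vmem C.
  by have /and3P[_ _] := components_partition; rewrite -C0 CQ.
have /eqP <- : component x == C by rewrite componentE.
by apply/dvdnP; exists (num_arrows x x); rewrite Qn connect0.
Qed.

Lemma num_components_neq0 x : num_components Q #|component x| != 0.
Proof.
rewrite -lt0n; apply/card_gt0P; exists (component x).
by rewrite inE component_in /=.
Qed.

End Quivers.

(** The isomorphism is built by three fibrewise matchings: components by size, then vertices by
    component, then arrows by their pair of endpoints. *)
Lemma uniform_same_shape (L M : Type) (Q : lquiver L) (R : lquiver M) n :
    uniform_arrows Q n -> uniform_arrows R n ->
    (forall s, num_components Q s = num_components R s) ->
  same_shape Q R.
Proof.
move=> Qn Rn QR.
pose cQ := {C | C \in components Q}; pose cR := {C | C \in components R}.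
have [b bij_b bP] : exists2 b : cQ -> cR, bijective b &
    forall C, #|val (b C)| = #|val C|.
  apply: (fibre_bijection (f := fun C : cQ => #|val C|)
    (g := fun C : cR => #|val C|)) => s.
  have cardval (S : finType) (P : {pred {set S}}) :
      #|[pred C : {C | C \in P} | #|val C| == s]| = #|[set C in P | #|C| == s]|.
    rewrite -(card_image val_inj) cardsE; apply: eq_card => C; rewrite [RHS]inE.
    apply/imageP/andP=> [[D /= Ds ->]|[CP Cs]]; first by rewrite (valP D).
    by exists (Sub C CP).
  have -> := cardval _ (mem (components Q)).
  by have -> := cardval _ (mem (components R)); apply: QR.
pose kQ := @class_of _ Q; pose kR := @class_of _ R.
have [v bij_v vP] : exists2 v : vertex Q -> vertex R, bijective v &
    forall x, kR (v x) = b (kQ x).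
  apply: (fibre_bijection (f := fun x => b (kQ x)) (g := kR)) => D.
  rewrite card_class_of.
  have [b' bK b'K] := bij_b; rewrite -{2}(b'K D) bP -card_class_of.
  by apply: eq_card => x; rewrite !inE -(can_eq b'K) bK.
have vcard x : #|component (v x)| = #|component x|.
  by have := bP (kQ x); rewrite -vP.
have vconn x y :
    connect (@adjacent _ R) (v x) (v y) = connect (@adjacent _ Q) x y.
  rewrite -!component_eq; have := congr1 val (vP x); have := congr1 val (vP y).
  rewrite /= => -> ->; rewrite val_eqE (bij_eq bij_b) -val_eqE //.
(* Uniformity fixes the product of the multiplicity with the component size, and that positive size
   is preserved by [v]. *)
have num x y : num_arrows (v x) (v y) = num_arrows x y.
  apply/eqP; rewrite -(eqn_pmul2r (component_gt0 x)) -{1}vcard.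
  by rewrite Qn Rn vconn.
have [e bij_e eP] : exists2 e : arrow Q -> arrow R, bijective e &
    forall x, (source (e x), target (e x)) = (v (source x), v (target x)).
  apply: (fibre_bijection (f := fun a => (v (source a), v (target a)))
    (g := fun a => (source a, target a))) => -[x y].
  have [v' vK v'K] := bij_v.
  transitivity (num_arrows (v (v' x)) (v (v' y))); last by rewrite !v'K.
  rewrite num; apply: eq_card => a; rewrite !inE xpair_eqE.
  by rewrite -{1}(v'K x) -{1}(v'K y) !(bij_eq bij_v).
by exists v, e; split=> // x; case: (eP x).
Qed.

(** * Nontrivial automorphisms of groups of order at least 3 *)

Section Automorphisms.

Variable A : finGroupType.

Lemma Aut_setT_neq1 (h : A -> A) a :
    injective h -> {morph h : a b / (a * b)%g} -> h a != a ->
  exists2 f, f \in Aut [set: A] & f != 1%g.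
Proof.
move=> inj_h hM ha; exists (perm inj_h).
  rewrite inE; apply/andP; split.
    by apply/subsetP=> b _; apply: in_setT.
  by apply/morphicP => b c _ _; rewrite !permE hM.
by apply: contraNneq ha => f1; rewrite -(permE inj_h) f1 perm1.
Qed.

(** Three cases: conjugation by a noncentral element, inversion on an abelian group with an element
    of order greater than 2, and a transvection on an elementary abelian 2-group. *)
Lemma Aut_setT_nontrivial :
  2 < #|A| -> exists2 f, f \in Aut [set: A] & f != 1%g.
Proof.
move=> A2; have [/centsP cAA|] := boolP (abelian [set: A]); last first.
  case/subsetPn=> x _ /centP xC.
  have [y] : exists y, ~~ ([~ y, x] == 1)%g.
    apply/existsP; rewrite -negb_forall; apply/forallP => C.
    by apply: xC => y _; apply/commute_sym/commgP/C.
  move/conjg_fixP/eqP; apply: (Aut_setT_neq1 (h := conjg^~ x)).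
    exact: conjg_inj.
  by move=> a b; rewrite conjMg.
have cAA' (a b : A) : (a * b = b * a)%g by apply: cAA.
have [|] := boolP (exponent [set: A] %| 2); last first.
  rewrite -sub_Ldiv => /subsetPn[x _]; rewrite !inE /= expgS expg1 => x2.
  apply: (Aut_setT_neq1 (h := @invg A) (a := x)); first exact: invg_inj.
    by move=> a b; rewrite invMg cAA'.
  by apply: contraNneq x2 => xV; rewrite -{2}xV mulgV.
(* What remains is an elementary abelian 2-group: take the transvection fixing
   a hyperplane M pointwise and translating its complement by some z in M. *)
move=> e2; have sq1 (a : A) : (a * a = 1)%g.
  by have /exponentP/(_ a (in_setT a)) := e2.
have pA := abelem_pgroup (exponent2_abelem e2).
have [z z1] : exists z : A, z != 1%g.
  have : 1 < #|[set: A]| by rewrite cardsT ltnW.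
  by rewrite cardG_gt1 => /trivgPn[z _]; exists z.
(* The subgroup generated by [z] has order at most 2, so it is proper and lies in a maximal
   subgroup, which has index 2. *)
have [zA|[M maxM]] := maximal_exists (subsetT <[z]>%g).
  have : #|<[z]>%g| <= 2.
    by rewrite -orderE dvdn_leq // order_dvdn expgS expg1 sq1.
  by rewrite zA cardsT leqNgt A2.
rewrite cycle_subG => zM.
have iM := p_maximal_index pA maxM.
have MN a b : a \notin M -> b \notin M -> (a * b)%g \in M.
  move=> aM bM; have : b \in (M :* a)%g.
    by rewrite (rcoset_index2 (subsetT M)) ?inE ?aM ?bM.
  by case/rcosetP => m mM ->; rewrite cAA' -mulgA sq1 mulg1.
have [x _ xM] : exists2 x, x \in [set: A] & x \notin M.
  by apply/subsetPn; case/maxgroupP: maxM => /proper_subn.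
pose h a := if a \in M then a else (a * z)%g.
have hM a : (h a \in M) = (a \in M).
  by rewrite /h; case: ifPn => // /negPf aM; rewrite groupMr ?aM.
(* Since [z] lies in [M], [h] preserves both cosets of [M], so applying it twice multiplies by 1 or
   by the square of [z]. *)
have hK : involutive h.
  move=> a; rewrite {1}/h hM /h; have [//|_] := boolP (a \in M).
  by rewrite -mulgA sq1 mulg1.
apply: (Aut_setT_neq1 (h := h) (a := x)); first exact: inv_inj; last first.
  by rewrite /h (negPf xM) -{2}[x]mulg1 (inj_eq (mulgI x)).
move=> a b; rewrite /h; have [aM|aM] := boolP (a \in M);
  have [bM|bM] := boolP (b \in M).
- by rewrite groupM.
- by rewrite groupMl // (negPf bM) mulgA.
- by rewrite groupMr // (negPf aM) -!mulgA (cAA' b).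
  by rewrite MN // mulgA -(mulgA a) (cAA' z) mulgA -mulgA sq1 mulg1.
Qed.

End Automorphisms.

(** * Regular subsets and the quiver of the holomorph *)

Section HolomorphQuiver.

Variable A : finGroupType.
Implicit Types S : hol_vertex A.

Let autA := [subg Aut [set: A]].

Lemma hol_elt_inj (S : {set hol A}) :
  S \in regular0 A -> {in S &, injective (@hol_elt A)}.
Proof. by case/andP=> /andP[/dinjectiveP]. Qed.

Lemma regular0_card (S : {set hol A}) : S \in regular0 A -> #|S| = #|A|.
Proof.
move=> regS; rewrite -(card_in_imset (hol_elt_inj regS)).
by case/andP: regS => /andP[_ /eqP->] _; rewrite cardsT.
Qed.

(** Regular subsets are encoded as graphs of maps into the automorphism group, so that counting them
    becomes counting functions. *)
Definition hol_graph (phi : {ffun A -> autA}) : {set hol A} :=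
  [set Hol a (phi a) | a in A].

Lemma mem_hol_graph phi x :
  (x \in hol_graph phi) = (hol_aut x == phi (hol_elt x)).
Proof.
by apply/imsetP/eqP => [[a _ ->] //|]; case: x => a f /= ->; exists a.
Qed.

Lemma hol_graph_inj : injective hol_graph.
Proof.
move=> phi psi /setP eq_g; apply/ffunP=> a; apply/eqP.
by have := eq_g (Hol a (phi a)); rewrite !mem_hol_graph eqxx => /esym.
Qed.

Lemma hol_graph_regular0 (phi : {ffun A -> autA}) :
  (hol_graph phi \in regular0 A) = (phi 1%g == 1%g).
Proof.
rewrite inE mem_hol_graph /= eq_sym andb_idl // => _.
apply/andP; split.
  apply/dinjectiveP => x y; rewrite !mem_hol_graph.
  by case: x y => a f [b g] /= /eqP-> /eqP-> ->.
apply/eqP/setP=> a; rewrite inE; apply/imsetP.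
by exists (Hol a (phi a)); rewrite ?mem_hol_graph.
Qed.

Lemma regular0_hol_graph (S : {set hol A}) :
  S \in regular0 A -> exists phi, S = hol_graph phi.
Proof.
move=> regS.
pose phi : {ffun A -> autA} := [ffun a =>
  if [pick x in S | hol_elt x == a] is Some x then hol_aut x else 1%g].
have sub : S \subset hol_graph phi.
  apply/subsetP=> x xS; rewrite mem_hol_graph ffunE.
  case: pickP => [y /andP[yS /eqP yx]|/(_ x)]; last by rewrite xS eqxx.
  by rewrite (hol_elt_inj regS yS xS yx).
exists phi; apply/eqP; rewrite eqEcard sub (regular0_card regS).
exact: leq_imset_card.
Qed.

Lemma card_regular0 : #|regular0 A| = #|Aut [set: A]| ^ (#|A| - 1).
Proof.
have -> : #|A| - 1 = #|[set~ 1%g : A]| by rewrite cardsC1 subn1.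
have -> : #|Aut [set: A]| = #|autA| by rewrite card_sub.
(* Maps with [phi 1 = 1] are those supported off 1, with default value the identity; each other
   point contributes a free choice. *)
rewrite -(card_pffun_on (1%g : autA) [set~ 1%g] predT).
rewrite -(card_image hol_graph_inj); apply: eq_card => S.
apply/idP/imageP=> [regS | [phi phi1 ->]].
  have [phi Sphi] := regular0_hol_graph regS; exists phi => //.
  apply/pffun_onP; split=> //; apply/supportP=> a; rewrite !inE negbK => /eqP->.
  by apply/eqP; rewrite -hol_graph_regular0 -Sphi.
rewrite hol_graph_regular0.
by have /pffun_onP[/supportP-> //] := phi1; rewrite !inE eqxx.
Qed.

Lemma num_arrowsE S S' : num_arrows (Q := hol_quiver A) S S'
  = #|[set x in val S | (x^-1 *: val S)%g == val S']|.
Proof.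
rewrite /num_arrows -(card_in_image (f := fun e : hol_arrow A => (val e).2)).
  apply: eq_card => x; rewrite !inE; apply/imageP/andP.
    case=> e /andP[/eqP <- /eqP <-] ->; split=> //; exact: (valP e).
  case=> xS /eqP xS'; exists (Sub (S, x) xS : hol_arrow A) => //.
  by rewrite inE -!val_eqE /= -xS' !eqxx.
move=> e1 e2 /andP[/eqP s1 _] /andP[/eqP s2 _] e12; apply/val_inj.
rewrite [LHS]surjective_pairing [RHS]surjective_pairing e12; congr pair.
exact: etrans s1 (esym s2).
Qed.

Definition lcoset_rel S S' := [exists x in val S, val S' == x^-1 *: val S]%g.

Lemma lcoset_relP S S' :
  reflect (exists2 x, x \in val S & val S' = x^-1 *: val S)%g (lcoset_rel S S').
Proof. exact: 'exists_in_eqP. Qed.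

Lemma lcoset_rel_refl S : lcoset_rel S S.
Proof.
apply/lcoset_relP; exists 1%g; last by rewrite invg1 lcoset1.
by case/andP: (valP S).
Qed.

Lemma lcoset_rel_trans S1 S2 S3 :
  lcoset_rel S1 S2 -> lcoset_rel S2 S3 -> lcoset_rel S1 S3.
Proof.
case/lcoset_relP=> x xS S12 /lcoset_relP[y yS S23]; apply/lcoset_relP.
exists (x * y)%g; last by rewrite S23 S12 -lcosetM -invMg.
by move: yS; rewrite S12 mem_lcoset invgK.
Qed.

Lemma lcoset_rel_sym S S' : lcoset_rel S S' -> lcoset_rel S' S.
Proof.
case/lcoset_relP=> x xS S12; apply/lcoset_relP; exists x^-1%g.
  by rewrite S12 mem_lcoset mulVg; case/andP: (valP S).
by rewrite S12 invgK lcosetKV.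
Qed.

(** Translation by the inverse of an element is already an equivalence on vertices, so every
    undirected path collapses to a single arrow. *)
Lemma connect_hol_quiver S S' :
  connect (@adjacent _ (hol_quiver A)) S S' = lcoset_rel S S'.
Proof.
have arr (e : hol_arrow A) : lcoset_rel (hol_source e) (hol_target e).
  by apply/lcoset_relP; exists (val e).2; first exact: (valP e).
apply/idP/idP=> [/connectP[p]|/lcoset_relP[x xS xS']].
  elim: p S => [|T p IH] S /=; first by move=> _ ->; apply: lcoset_rel_refl.
  case/andP=> /existsP[e eST] /IH{}IH /IH; apply: lcoset_rel_trans.
  case/orP: eST => /andP[/eqP <- /eqP <-]; last apply: lcoset_rel_sym.
    exact: arr.
  exact: arr.
apply/connect1/existsP; exists (Sub (S, x) xS : hol_arrow A).
by rewrite -!val_eqE /= xS' !eqxx.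
Qed.

(** Since 1 lies in [S], this is the full stabilizer of [S] under left translation. *)
Definition stabilizer S := [set x in val S | (x^-1 *: val S == val S)%g].

(* The arrows from S to x^-1 S form the right coset of x by the stabilizer. *)
Lemma num_arrows_stabilizer S S' : num_arrows (Q := hol_quiver A) S S' =
  if lcoset_rel S S' then #|stabilizer S| else 0.
Proof.
rewrite num_arrowsE; case: lcoset_relP => [[x xS S12]|noS].
  rewrite -(card_rcoset (stabilizer S) x); apply: eq_card => y.
  rewrite mem_rcoset !inE.
  have S1 : 1%g \in val S by case/andP: (valP S).
  have mem1 (z : hol A) : (1%g \in (z^-1 *: val S)%g) = (z \in val S).
    by rewrite mem_lcoset invgK mulg1.
  rewrite andb_idl => [|/eqP yS]; last by rewrite -mem1 yS S12 mem1.
  rewrite [RHS]andb_idl => [|/eqP yS]; last by rewrite -mem1 yS.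
  rewrite S12 invMg invgK lcosetM.
  by apply/eqP/eqP => [->|{2}<-]; rewrite ?lcosetK ?lcosetKV.
apply/eqP; rewrite cards_eq0; apply/eqP/setP=> x; rewrite !inE.
by apply/andP=> -[xS /eqP xS']; case: noS; exists x.
Qed.

(** The [#|A|] arrows leaving [S] are sorted by target: every vertex of the component receives as
    many as the stabilizer has elements. *)
Lemma hol_quiver_uniform : uniform_arrows (hol_quiver A) #|A|.
Proof.
move=> S S0; rewrite num_arrows_stabilizer connect_hol_quiver.
case: ifP => // _; rewrite -(regular0_card (valP S)) -[RHS]sum1_card.
(* The default [S] of [insubd] is never reached, as [x] ranges over [S]. *)
rewrite (partition_big (fun x => insubd S (x^-1 *: val S)%g) xpredT) //=.
transitivity (\sum_(T : vertex (hol_quiver A)) num_arrows S T).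
  rewrite mulnC -sum_nat_const big_mkcond; apply: eq_bigr => T _.
  rewrite num_arrows_stabilizer -connect_hol_quiver.
  by rewrite -(@mem_component _ (hol_quiver A)).
apply: eq_bigr => T _; rewrite num_arrowsE -sum1_card; apply: eq_bigl => x.
rewrite inE; apply: andb_id2l => xS.
by rewrite -[RHS](inj_eq val_inj) insubdK // regular0_lcoset ?(valP S).
Qed.

Lemma hol_quiver_large_component :
  2 < #|A| -> num_components (hol_quiver A) #|A| != 0.
Proof.
move=> A2; have [f fA f1] := Aut_setT_nontrivial A2.
pose phi := [ffun a : A => if a == 1%g then 1%g else subg (Aut [set: A]) f].
have regS : hol_graph phi \in regular0 A.
  by rewrite hol_graph_regular0 ffunE eqxx.
pose S : hol_vertex A := Sub (hol_graph phi) regS.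
suff stabS : stabilizer S = [set 1%g].
  have := hol_quiver_uniform S S; rewrite connect0 num_arrows_stabilizer.
  rewrite lcoset_rel_refl stabS cards1 mul1n => <-.
  exact: num_components_neq0.
have S1 : 1%g \in val S by case/andP: (valP S).
apply/setP=> x; rewrite !inE; apply/andP/eqP => [[xS /eqP xSS]|->]; last first.
  by rewrite invg1 lcoset1.
have phi_neq1 a : a != 1%g -> phi a = subg _ f by rewrite ffunE => /negPf->.
have mulxS y : y \in val S -> (x * y)%g \in val S.
  by move=> yS; rewrite -{1}xSS mem_lcoset invgK in yS.
move: (xS); rewrite /= mem_hol_graph => /eqP xphi.
have [x1|x1] := eqVneq (hol_elt x) 1%g.
  by case: (x) xphi x1 => a g /= -> ->; rewrite ffunE eqxx.
(* The product of [x] and [(b, f)] stays in [S] and has automorphism part [f * f], which differs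
   from [f]; only 1 is left for its first component. *)
have app_x b : b != 1%g -> (hol_elt x * hol_app x b = 1)%g.
  move=> b1; apply: contraNeq f1 => xb1.
  have /mulxS : Hol b (phi b) \in val S by rewrite /= mem_hol_graph.
  rewrite /= mem_hol_graph /= xphi !phi_neq1 // -[X in _ == X]mulg1.
  by rewrite (inj_eq (mulgI _)) -(inj_eq subg_inj) subgK.
(* Two distinct nonidentity elements would then have the same image under the automorphism of
   [x]. *)
have /card_gt1P[b [c [b1 c1]]] : 1 < #|[set~ 1%g : A]|.
  by rewrite cardsC1 -ltnS prednK // ltnW // ltnW.
rewrite !inE in b1 c1; case/eqP; apply: (@hol_app_inj _ x).
by apply: (mulgI (hol_elt x)); rewrite !app_x.
Qed.

End HolomorphQuiver.

(** * Recovering the group order from the component counts *)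

Lemma hol_quiver_card_dvd (A B : finGroupType) :
    2 < #|A| ->
    (forall s,
       num_components (hol_quiver A) s = num_components (hol_quiver B) s) ->
  #|A| %| #|B|.
Proof.
move=> A2 AB; apply: contraTT (hol_quiver_large_component A2) => ndvd.
by rewrite negbK AB (num_components_ndvd (@hol_quiver_uniform B)).
Qed.

Lemma hol_quiver_card_eq (A B : finGroupType) :
    (#|A| = 1 <-> #|B| = 1) ->
    (forall s,
       num_components (hol_quiver A) s = num_components (hol_quiver B) s) ->
  #|A| = #|B|.
Proof.
move=> AB1 AB.
have A0 : 0 < #|A| by apply/card_gt0P; exists 1%g.
have B0 : 0 < #|B| by apply/card_gt0P; exists 1%g.
have AdvdB : 2 < #|A| -> #|A| %| #|B| by move/hol_quiver_card_dvd; apply.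
have BdvdA : 2 < #|B| -> #|B| %| #|A|.
  by move/hol_quiver_card_dvd; apply=> s; rewrite AB.
(* If one order exceeds 2 it divides the other, which then exceeds 2 as well and divides back.
   Otherwise both orders are 1 or 2, and [AB1] separates these. *)
have [A2|A2] := ltnP 2 #|A|.
  apply/eqP; rewrite eqn_dvd AdvdB // BdvdA //.
  exact: leq_trans A2 (dvdn_leq B0 (AdvdB A2)).
have [B2|B2] := ltnP 2 #|B|.
  by have := leq_trans B2 (dvdn_leq A0 (BdvdA B2)); rewrite ltnNge A2.
by case: #|A| #|B| AB1 A0 B0 A2 B2 => [|[|[|a]]] [|[|[|b]]] // [AB1 BA1] *;
  [rewrite AB1 | rewrite BA1].
Qed.

Theorem mainTheorem4 (A : finGroupType) :
  [/\ forall B : finGroupType,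
        (#|A| = 1 <-> #|B| = 1) ->
        (forall s : nat,
           num_components (hol_quiver A) s = num_components (hol_quiver B) s) ->
        same_shape (hol_quiver A) (hol_quiver B),
      forall s : nat, ~~ (s %| #|A|) -> num_components (hol_quiver A) s = 0,
      \sum_(0 <= s < #|regular0 A|.+1) s * num_components (hol_quiver A) s
        = #|regular0 A|
    & #|regular0 A| = #|Aut [set: A]| ^ (#|A| - 1)].
Proof.
split.
- move=> B AB1 AB; apply: (uniform_same_shape (@hol_quiver_uniform A) _ AB).
  by rewrite (hol_quiver_card_eq AB1 AB); apply: hol_quiver_uniform.
- by move=> s; apply: num_components_ndvd; apply: hol_quiver_uniform.
- have := sum_num_components (hol_quiver A).
  by have -> : #|vertex (hol_quiver A)| = #|regular0 A| by rewrite card_sub.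
exact: card_regular0.
Qed.
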